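(* Let $\mathbb{k}$ be a commutative ring, let $\mathcal{G}$ be a finite groupoid, and let $S$ be a $\mathcal{G}$-set. Let $\mathcal{G}\cong\coprod_{i=1}^n\mathcal{G}_{[i]}$ be the decomposition of $\mathcal{G}$ into its connected components. Then there is an isomorphism of rings $$Z\big(\mathbb{k}\text{-}\mathbf{mod}^{\mathcal{G}}(\mathbb{k}[S],\mathbb{k}[S])\big)\cong\prod_{x\in\pi_0(\mathcal{G})}Z\big(\mathbb{k}\text{-}\mathbf{mod}^{\mathcal{G}_x}(\mathbb{k}[S\circ\mathrm{Incl}^{\mathcal{G}}_{\mathcal{G}_x}],\mathbb{k}[S\circ\mathrm{Incl}^{\mathcal{G}}_{\mathcal{G}_x}])\big),$$ where the product runs over a set of objects $x$ representing the connected components of $\mathcal{G}$ (one object per component).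
   Context: A groupoid is a (small) category in which every morphism is invertible; $\mathcal{G}_0$ is the set of objects, and finiteness means finitely many objects and morphisms. For $x\in\mathcal{G}_0$, $\mathcal{G}_x:=\mathcal{G}(x,x)$ is the isotropy group at $x$, also viewed as the subgroupoid of $\mathcal{G}$ with the single object $x$; $\mathrm{Incl}^{\mathcal{G}}_{\mathcal{G}_x}:\mathcal{G}_x\to\mathcal{G}$ is the inclusion functor. $\pi_0(\mathcal{G})$ is the set of connected components, i.e. of equivalence classes of objects under ''there is a morphism $x\to y$''. $Z(A)$ denotes the center of a ring $A$. A $\mathcal{G}$-set is a functor from $\mathcal{G}$ to the category of finite sets. $\mathbb{k}\text{-}\mathbf{mod}$ is the category of finitely generated $\mathbb{k}$-modules and $\mathbb{k}\text{-}\mathbf{mod}^{\mathcal{G}}$ is the category of functors $\mathcal{G}\to\mathbb{k}\text{-}\mathbf{mod}$ and natural transformations. For a $\mathcal{G}$-set $X$, $\mathbb{k}[X]:\mathcal{G}\to\mathbb{k}\text{-}\mathbf{mod}$ sends $x$ to the free module $\mathbb{k}[X(x)]$ on $X(x)$ and a morphism $g$ to the $\mathbb{k}$-linear extension of $X(g)$. The endomorphism set $\mathbb{k}\text{-}\mathbf{mod}^{\mathcal{G}}(\mathbb{k}[X],\mathbb{k}[X])$ (natural transformations $\mathbb{k}[X]\to\mathbb{k}[X]$) is a ring under objectwise addition and composition. *)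

(* Defs.v *)
From HB Require Import structures.
From mathcomp Require Import all_boot all_algebra.
From mathcomp Require Import boolp.

Set Implicit Arguments.
Unset Strict Implicit.
Unset Printing Implicit Defensive.

Import GRing.Theory.
Local Open Scope ring_scope.

(* [gcomp g f] is the composite "g after f". *)
Record finGroupoid := FinGroupoid {
  gobj :> finType;
  ghom : gobj -> gobj -> finType;
  gid : forall x, ghom x x;
  gcomp : forall x y z, ghom y z -> ghom x y -> ghom x z;
  ginv : forall x y, ghom x y -> ghom y x;
  gcompA : forall x y z t (h : ghom z t) (g : ghom y z) (f : ghom x y),
    gcomp h (gcomp g f) = gcomp (gcomp h g) f;
  gcomp1g : forall x y (f : ghom x y), gcomp (gid y) f = f;
  gcompg1 : forall x y (f : ghom x y), gcomp f (gid x) = f;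
  gcompVg : forall x y (f : ghom x y), gcomp (ginv f) f = gid x;
  gcompgV : forall x y (f : ghom x y), gcomp f (ginv f) = gid y }.

Arguments gid {f} x : rename.
Arguments gcomp {f x y z} g h : rename.
Arguments ginv {f x y} g : rename.

Section Components.
Variable G : finGroupoid.

Definition gconnected : rel G := fun x y => (0 < #|ghom x y|)%N.

Definition pi0 : {set {set G}} := equivalence_partition gconnected [set: G].

End Components.

Record gfunctor (H G : finGroupoid) := GFunctor {
  gfun_obj :> H -> G;
  gfun_map : forall x y, ghom x y -> ghom (gfun_obj x) (gfun_obj y);
  gfun_id : forall x, gfun_map (gid x) = gid (gfun_obj x);
  gfun_comp : forall x y z (g : ghom y z) (f : ghom x y),
    gfun_map (gcomp g f) = gcomp (gfun_map g) (gfun_map f) }.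

Section Isotropy.
Variables (G : finGroupoid) (x : G).

(* The single object [x] is represented by [tt]. *)
Definition isotropy : finGroupoid :=
  @FinGroupoid unit (fun _ _ => ghom x x) (fun _ => gid x)
    (fun _ _ _ g f => gcomp g f) (fun _ _ f => ginv f)
    (fun _ _ _ _ h g f => gcompA h g f)
    (fun _ _ f => gcomp1g f) (fun _ _ f => gcompg1 f)
    (fun _ _ f => gcompVg f) (fun _ _ f => gcompgV f).

Definition isotropy_incl : gfunctor isotropy G :=
  @GFunctor isotropy G (fun _ => x) (fun _ _ g => g)
    (fun _ => erefl) (fun _ _ _ _ _ => erefl).

End Isotropy.

Record gset (G : finGroupoid) := GSet {
  gset_obj :> G -> finType;
  gset_map : forall x y, ghom x y -> gset_obj x -> gset_obj y;
  gset_id : forall x (s : gset_obj x), gset_map (gid x) s = s;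
  gset_comp : forall x y z (g : ghom y z) (f : ghom x y) (s : gset_obj x),
    gset_map (gcomp g f) s = gset_map g (gset_map f s) }.

Definition gset_restr (H G : finGroupoid) (S : gset G) (F : gfunctor H G) :
  gset H.
Proof.
refine (@GSet H (fun x => S (F x)) (fun x y g => gset_map (gfun_map F g)) _ _).
- by move=> x s; rewrite gfun_id gset_id.
- by move=> x y z g f s; rewrite gfun_comp gset_comp.
Defined.

Definition finitely_generated (k : comPzRingType) (M : lmodType k) : Prop :=
  exists (n : nat) (e : 'I_n -> M),
    forall v : M, exists c : 'I_n -> k, v = \sum_(i < n) c i *: e i.

Section FunctorCategory.
Variables (k : comPzRingType) (G : finGroupoid).

Record kfunctor := KFunctor {
  kfun_obj :> G -> lmodType k;
  kfun_fg : forall x, finitely_generated (kfun_obj x);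
  kfun_map : forall x y, ghom x y -> {linear kfun_obj x -> kfun_obj y};
  kfun_id : forall x (v : kfun_obj x), kfun_map (gid x) v = v;
  kfun_comp : forall x y z (g : ghom y z) (f : ghom x y) (v : kfun_obj x),
    kfun_map (gcomp g f) v = kfun_map g (kfun_map f v) }.

Record nat_trans (M N : kfunctor) := NatTrans {
  nt_app :> forall x, {linear M x -> N x};
  nt_natural : forall x y (g : ghom x y) (v : M x),
    nt_app y (kfun_map M g v) = kfun_map N g (nt_app x v) }.

HB.instance Definition _ M N := gen_eqMixin (nat_trans M N).
HB.instance Definition _ M N := gen_choiceMixin (nat_trans M N).

Lemma linear_ext (U V : lmodType k) (f g : {linear U -> V}) :
  f =1 g -> f = g.
Proof.
case: f g => [f [[af] [lf]]] [g [[ag] [lg]]] /= /funext fg.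
by subst g; rewrite (Prop_irrelevance af ag) (Prop_irrelevance lf lg).
Qed.

Lemma nat_transP (M N : kfunctor) (a b : nat_trans M N) :
  (forall x v, a x v = b x v) -> a = b.
Proof.
case: a b => [a na] [b nb] /= ab.
have eab : a = b.
  by apply: functional_extensionality_dep => x; apply: linear_ext => v; apply: ab.
by subst b; rewrite (Prop_irrelevance na nb).
Qed.

Section Additive.
Variables M N : kfunctor.
Implicit Types a b c : nat_trans M N.

Definition nt_zero : nat_trans M N.
Proof.
by exists (fun x => (\0 : {linear M x -> N x})) => x y g v; rewrite /= linear0.
Defined.

Definition nt_opp a : nat_trans M N.
Proof.
exists (fun x => (\- a x : {linear M x -> N x})) => x y g v.
by rewrite /= nt_natural linearN.
Defined.

Definition nt_add a b : nat_trans M N.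
Proof.
exists (fun x => (a x \+ b x : {linear M x -> N x})) => x y g v.
by rewrite /= !nt_natural linearD.
Defined.

Fact nt_addA : associative nt_add.
Proof. by move=> a b c; apply: nat_transP => x v /=; rewrite addrA. Qed.
Fact nt_addC : commutative nt_add.
Proof. by move=> a b; apply: nat_transP => x v /=; rewrite addrC. Qed.
Fact nt_add0 : left_id nt_zero nt_add.
Proof. by move=> a; apply: nat_transP => x v /=; rewrite add0r. Qed.
Fact nt_addN : left_inverse nt_zero nt_opp nt_add.
Proof. by move=> a; apply: nat_transP => x v /=; rewrite addNr. Qed.

HB.instance Definition _ := GRing.isZmodule.Build (nat_trans M N)
  nt_addA nt_addC nt_add0 nt_addN.

End Additive.

Definition kEnd (M : kfunctor) : Type := nat_trans M M.
HB.instance Definition _ M := GRing.Zmodule.on (kEnd M).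

Section EndRing.
Variable M : kfunctor.
Implicit Types a b c : kEnd M.

Definition nt_one : kEnd M.
Proof. by exists (fun x => (idfun : {linear M x -> M x})). Defined.

Definition nt_mul a b : kEnd M.
Proof.
exists (fun x => (a x \o b x : {linear M x -> M x})) => x y g v.
by rewrite /= !nt_natural.
Defined.

Fact nt_mulA : associative nt_mul.
Proof. by move=> a b c; apply: nat_transP. Qed.
Fact nt_mul1l : left_id nt_one nt_mul.
Proof. by move=> a; apply: nat_transP. Qed.
Fact nt_mul1r : right_id nt_one nt_mul.
Proof. by move=> a; apply: nat_transP. Qed.
Fact nt_mulDl : left_distributive nt_mul +%R.
Proof. by move=> a b c; apply: nat_transP. Qed.
Fact nt_mulDr : right_distributive nt_mul +%R.
Proof. by move=> a b c; apply: nat_transP => x v /=; rewrite linearD. Qed.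

HB.instance Definition _ := GRing.Zmodule_isPzRing.Build (kEnd M)
  nt_mulA nt_mul1l nt_mul1r nt_mulDl nt_mulDr.

End EndRing.

End FunctorCategory.

Section FreeModule.
Variable k : comPzRingType.

(* The free module on the finite set [T]; the element [t] is [free_elt t]. *)
Definition free_mod (T : finType) : lmodType k := {ffun T -> k^o}.

Definition free_elt (T : finType) (t : T) : free_mod T :=
  [ffun u => (u == t)%:R].

Definition free_map (T U : finType) (f : T -> U) (v : free_mod T) :
  free_mod U := \sum_t (v t : k) *: free_elt (f t).

Fact free_map_linear (T U : finType) (f : T -> U) : linear (free_map f).
Proof.
move=> c u v; rewrite /free_map scaler_sumr -big_split /=.
by apply: eq_bigr => t _; rewrite !ffunE scalerA -scalerDl.
Qed.

HB.instance Definition _ (T U : finType) (f : T -> U) :=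
  GRing.isLinear.Build k (free_mod T) (free_mod U) *:%R (free_map f)
    (free_map_linear f).

Lemma free_modE (T : finType) (v : free_mod T) :
  v = \sum_t (v t : k) *: free_elt t.
Proof.
apply/ffunP => u; rewrite sum_ffunE (bigD1 u) //= !ffunE eqxx big1 => [|t tu].
  by rewrite addr0 /GRing.scale /= mulr1.
by rewrite !ffunE eq_sym (negPf tu) scaler0.
Qed.

Lemma free_map_elt (T U : finType) (f : T -> U) t :
  free_map f (free_elt t) = free_elt (f t).
Proof.
rewrite /free_map (bigD1 t) //= ffunE eqxx scale1r big1 ?addr0 // => u ut.
by rewrite ffunE (negPf ut) scale0r.
Qed.

Lemma free_mod_fg (T : finType) : finitely_generated (free_mod T).
Proof.
exists #|T|, (fun i => free_elt (enum_val i)) => v.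
exists (fun i => v (enum_val i)); rewrite [LHS]free_modE.
by rewrite (reindex (@enum_val T T)) //; apply/onW_bij/enum_val_bij.
Qed.

Variables (G : finGroupoid) (S : gset G).

Definition klin : kfunctor k G.
Proof.
refine (@KFunctor k G (fun x => free_mod (S x)) (fun x => free_mod_fg (S x))
  (fun x y g =>
     (free_map (gset_map g) : {linear free_mod (S x) -> free_mod (S y)})) _ _).
- move=> x v; rewrite [RHS]free_modE; apply: eq_bigr => s _.
  by rewrite gset_id.
- move=> x y z g f v; rewrite /= [free_map (gset_map f) v]/free_map linear_sum.
  by apply: eq_bigr => s _; rewrite linearZ /= free_map_elt gset_comp.
Defined.

End FreeModule.

Section Center.
Variable R : pzRingType.

Definition in_center : {pred R} := [pred x : R | `[< forall y, x * y = y * x >]].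

Lemma in_centerP x : reflect (forall y, x * y = y * x) (x \in in_center).
Proof. exact: asboolP. Qed.

Fact in_center_subring : subring_closed in_center.
Proof.
split=> [|x y /in_centerP cx /in_centerP cy|x y /in_centerP cx /in_centerP cy];
  apply/in_centerP => z.
- by rewrite mul1r mulr1.
- by rewrite mulrBl mulrBr cx cy.
- by rewrite -mulrA cy mulrA cx mulrA.
Qed.

HB.instance Definition _ :=
  GRing.isSubringClosed.Build R in_center in_center_subring.

Record center := Center { center_val :> R; _ : center_val \in in_center }.

HB.instance Definition _ := [isSub for center_val].
HB.instance Definition _ := [Choice of center by <:].
HB.instance Definition _ :=
  GRing.SubChoice_isSubPzRing.Build R in_center center (GRing.subringClosedP _).

End Center.

Section RingProduct.
Variables (I : Type) (R : I -> pzRingType).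

Definition ring_prod : Type := forall i, R i.
Implicit Types f g h : ring_prod.

HB.instance Definition _ := gen_eqMixin ring_prod.
HB.instance Definition _ := gen_choiceMixin ring_prod.

Lemma ring_prodP f g : (forall i, f i = g i) -> f = g.
Proof. exact: functional_extensionality_dep. Qed.

Let zero : ring_prod := fun i => 0.
Let opp f : ring_prod := fun i => - f i.
Let add f g : ring_prod := fun i => f i + g i.
Let one : ring_prod := fun i => 1.
Let mul f g : ring_prod := fun i => f i * g i.

Fact ring_prod_addA : associative add.
Proof. by move=> f g h; apply: ring_prodP => i; exact: addrA. Qed.
Fact ring_prod_addC : commutative add.
Proof. by move=> f g; apply: ring_prodP => i; exact: addrC. Qed.
Fact ring_prod_add0 : left_id zero add.
Proof. by move=> f; apply: ring_prodP => i; exact: add0r. Qed.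
Fact ring_prod_addN : left_inverse zero opp add.
Proof. by move=> f; apply: ring_prodP => i; exact: addNr. Qed.
HB.instance Definition _ := GRing.isZmodule.Build ring_prod
  ring_prod_addA ring_prod_addC ring_prod_add0 ring_prod_addN.

Fact ring_prod_mulA : associative mul.
Proof. by move=> f g h; apply: ring_prodP => i; exact: mulrA. Qed.
Fact ring_prod_mul1l : left_id one mul.
Proof. by move=> f; apply: ring_prodP => i; exact: mul1r. Qed.
Fact ring_prod_mul1r : right_id one mul.
Proof. by move=> f; apply: ring_prodP => i; exact: mulr1. Qed.
Fact ring_prod_mulDl : left_distributive mul +%R.
Proof. by move=> f g h; apply: ring_prodP => i; exact: mulrDl. Qed.
Fact ring_prod_mulDr : right_distributive mul +%R.
Proof. by move=> f g h; apply: ring_prodP => i; exact: mulrDr. Qed.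
HB.instance Definition _ := GRing.Zmodule_isPzRing.Build ring_prod
  ring_prod_mulA ring_prod_mul1l ring_prod_mul1r
  ring_prod_mulDl ring_prod_mulDr.

End RingProduct.

Definition ring_isomorphic (A B : pzRingType) : Prop :=
  exists f : {rmorphism A -> B}, bijective f.

(* Main.v *)
(* Restricting an endomorphism of [M : G -> k-mod] to the isotropy groups at the
   representatives [rep C] is already an isomorphism from [End M] onto the
   product of the endomorphism rings of the restrictions.  Given [h : rep C -> x],
   naturality forces the component at [x] to be [M h \o b C \o M h^-1], and the
   result does not depend on [h] because [b C] commutes with the isotropy group.
   It remains to take centers, which commutes with products of rings. *)
Require Import Defs.
From HB Require Import structures.
From mathcomp Require Import all_boot all_algebra.
From mathcomp Require Import boolp.

Set Implicit Arguments.
Unset Strict Implicit.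
Unset Printing Implicit Defensive.

Import GRing.Theory.
Local Open Scope ring_scope.

Lemma ring_isomorphic_trans (A B C : pzRingType) :
  ring_isomorphic A B -> ring_isomorphic B C -> ring_isomorphic A C.
Proof.
by move=> [f bf] [g bg]; exists (g \o f : {rmorphism A -> C}); apply: bij_comp.
Qed.

Lemma ring_isomorphic_intro (A B : pzRingType) (f : A -> B) :
  (forall x y, f (x - y) = f x - f y) -> f 1 = 1 ->
  (forall x y, f (x * y) = f x * f y) -> bijective f -> ring_isomorphic A B.
Proof.
move=> fB f1 fM bf.
pose fa := GRing.isZmodMorphism.Build A B f fB.
pose fm := GRing.isMonoidMorphism.Build A B f (conj f1 fM).
pose F : {rmorphism A -> B} := HB.pack f fa fm.
by exists F.
Qed.

Lemma ring_isomorphic_center (A B : pzRingType) :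
  ring_isomorphic A B -> ring_isomorphic (center A) (center B).
Proof.
move=> [f [g fK gK]].
have fC (x : center A) : f (val x) \in @in_center B.
  apply/in_centerP => y; rewrite -[y]gK -!rmorphM.
  congr (f _); exact/in_centerP/(valP x).
have gC (y : center B) : g (val y) \in @in_center A.
  (* [g] is only known as a set-theoretic inverse, so commutation is checked after applying the
     injective morphism [f]. *)
  apply/in_centerP => x; apply: (can_inj fK); rewrite !rmorphM gK.
  exact/in_centerP/(valP y).
apply: (@ring_isomorphic_intro _ _ (fun x => Center (fC x))).
- by move=> x y; apply: val_inj; rewrite /= !raddfB.
- by apply: val_inj; rewrite /= rmorph1.
- by move=> x y; apply: val_inj; rewrite /= rmorphM.
exists (fun y => Center (gC y)) => [x|y]; apply: val_inj; first exact: fK.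
exact: gK.
Qed.

Lemma center_ring_prod (I : eqType) (R : I -> pzRingType) :
  ring_isomorphic (center (ring_prod R)) (ring_prod (fun i => center (R i))).
Proof.
have fC (z : center (ring_prod R)) i : (val z : ring_prod R) i \in @in_center (R i).
  apply/in_centerP => y; case: z => z /= /in_centerP.
  (* Test centrality against the family that is [y] at [i] and [0] elsewhere, then read off the
     coordinate [i]. *)
  move=> /(_ (dfwith (0 : ring_prod R) y)) /(congr1 (@^~ i)).
  by rewrite /GRing.mul /= dfwith_in.
have gC (w : ring_prod (fun i => center (R i))) :
    ((fun i => val (w i)) : ring_prod R) \in @in_center (ring_prod R).
  apply/in_centerP => y; apply: ring_prodP => i; rewrite /GRing.mul /=.
  exact/in_centerP/(valP (w i)).
apply: (@ring_isomorphic_intro _ _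
  (fun z => (fun i => Center (fC z i)) : ring_prod (fun i => center (R i)))).
- by move=> x y; apply: ring_prodP => i; apply: val_inj.
- by apply: ring_prodP => i; apply: val_inj.
- by move=> x y; apply: ring_prodP => i; apply: val_inj.
exists (fun w => Center (gC w)) => [z|w]; first exact: val_inj.
by apply: ring_prodP => i; apply: val_inj.
Qed.

Section Restriction.
Variables (k : comPzRingType) (H G : finGroupoid) (F : gfunctor H G).

Definition krestr (M : kfunctor k G) : kfunctor k H.
Proof.
refine (@KFunctor k H (fun x => M (F x)) (fun x => kfun_fg M (F x))
  (fun x y g => kfun_map M (gfun_map F g)) _ _).
- by move=> x v; rewrite gfun_id kfun_id.
- by move=> x y z g f v; rewrite gfun_comp kfun_comp.
Defined.

(** Objects and maps agree by conversion and only proofs of the functor laws differ, hence an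
    equality rather than an isomorphism. *)
Lemma klin_restr (S : gset G) : klin k (gset_restr S F) = krestr (klin k S).
Proof. by congr KFunctor; apply: Prop_irrelevance. Qed.

End Restriction.

Section Components.
Variable G : finGroupoid.

Lemma gconnectedP (x y : G) : reflect (exists _ : ghom x y, True) (gconnected x y).
Proof. by apply: (iffP card_gt0P) => -[g _]; exists g. Qed.

Fact component_proof (x : G) :
  [set y in [set: G] | gconnected x y] \in pi0 G.
Proof. exact: imset_f. Qed.

Definition component (x : G) : {C : {set G} | C \in pi0 G} :=
  exist (fun C => C \in pi0 G) _ (component_proof x).

(** Precomposing with [g] or its inverse exchanges arrows out of [x] and arrows out of [y]. *)
Lemma component_hom (x y : G) : ghom x y -> component x = component y.
Proof.
move=> g; apply: val_inj; apply/setP => z; rewrite !inE /=.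
apply/gconnectedP/gconnectedP => -[h _]; last by exists (gcomp h g).
by exists (gcomp h (ginv g)).
Qed.

Lemma component_mem (C : {C : {set G} | C \in pi0 G}) x :
  x \in val C -> component x = C.
Proof.
case/imsetP: (valP C) => z _ eC; rewrite eC !inE /= => /gconnectedP[g _].
by rewrite -(component_hom g); apply: val_inj.
Qed.

End Components.

Section EndRestriction.
Variables (k : comPzRingType) (G : finGroupoid) (M : kfunctor k G).
Variable rep : {C : {set G} | C \in pi0 G} -> G.
Hypothesis hrep : forall C, rep C \in val C.

Lemma rep_hom (x : G) : exists _ : ghom (rep (component x)) x, True.
Proof.
have := hrep (component x); rewrite !inE /= => /gconnectedP[h _].
by exists (ginv h).
Qed.

Definition to_rep x : ghom (rep (component x)) x := sval (cid (rep_hom x)).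

Lemma kfun_mapK x y (g : ghom x y) : cancel (kfun_map M g) (kfun_map M (ginv g)).
Proof. by move=> v; rewrite -kfun_comp gcompVg kfun_id. Qed.

Lemma kfun_mapVK x y (g : ghom x y) : cancel (kfun_map M (ginv g)) (kfun_map M g).
Proof. by move=> v; rewrite -kfun_comp gcompgV kfun_id. Qed.

Let Mrep C := krestr (isotropy_incl (rep C)) M.
Let ends := ring_prod (fun C => kEnd (Mrep C)).

Definition end_restr (a : kEnd M) : ends :=
  fun C => @NatTrans k _ (Mrep C) (Mrep C) (fun=> a (rep C))
    (fun _ _ g v => nt_natural a g v).

(** [C] and [h] are left free, so that conjugations along different arrows to the same object can be
    compared. *)
Definition conj_app (b : ends) C x (h : ghom (rep C) x) : {linear M x -> M x} :=
  kfun_map M h \o b C tt \o kfun_map M (ginv h).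

(** The loop [ginv h' g h] at [rep C] commutes with [b C]. General [g] yields naturality of the
    extension, and [g] an identity yields independence of the arrow. [C = D] is a hypothesis because
    components of connected objects are equal only propositionally. *)
Lemma conj_app_natural (b : ends) C D x y
    (h : ghom (rep C) x) (h' : ghom (rep D) y) (g : ghom x y) v : C = D ->
  conj_app b h' (kfun_map M g v) = kfun_map M g (conj_app b h v).
Proof.
move=> eCD; case: D / eCD in h' *; rewrite /conj_app /=.
(* Writing [v] as the image of [w] under [h] makes the loop appear. *)
rewrite -{1}[v](kfun_mapVK h); move: (kfun_map M (ginv h) v) => w.
rewrite -!kfun_comp.
have /= -> := nt_natural (b C)
  (gcomp (ginv h') (gcomp g h) : @ghom (isotropy (rep C)) tt tt).
by rewrite -kfun_comp gcompA gcompgV gcomp1g.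
Qed.

Definition end_extend (b : ends) : kEnd M :=
  NatTrans (fun x y g v =>
    conj_app_natural b (to_rep x) (to_rep y) g v (component_hom g)).

Lemma end_restr_isomorphic : ring_isomorphic (kEnd M) ends.
Proof.
apply: (@ring_isomorphic_intro _ _ end_restr).
- by move=> a b; apply: ring_prodP => C; apply: nat_transP.
- by apply: ring_prodP => C; apply: nat_transP.
- by move=> a b; apply: ring_prodP => C; apply: nat_transP.
exists end_extend => [a|b].
  (* Naturality of [a] along [to_rep x] cancels the conjugation. *)
  by apply: nat_transP => x v; rewrite /= -nt_natural kfun_mapVK.
apply: ring_prodP => C; apply: nat_transP => -[] v /=.
(* The arrow chosen at [rep C] need not be the identity; independence of the arrow replaces it by
   [gid], where conjugation is trivial. *)
have := conj_app_natural b (gid (rep C)) (to_rep (rep C)) (gid _) v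
  (esym (component_mem (hrep C))).
rewrite !kfun_id /conj_app /= => ->.
have -> : ginv (gid (rep C)) = gid (rep C) by rewrite -[LHS]gcomp1g gcompgV.
by rewrite !kfun_id.
Qed.

End EndRestriction.

Theorem theorem3p3 (k : comPzRingType) (G : finGroupoid) (S : gset G)
    (rep : {C : {set G} | C \in pi0 G} -> G)
    (hrep : forall C, rep C \in val C) :
  ring_isomorphic
    (center (kEnd (klin k S)))
    (ring_prod (fun C : {C : {set G} | C \in pi0 G} =>
       center (kEnd (klin k (gset_restr S (isotropy_incl (rep C))))))).
Proof.
(* Every factor becomes a restriction of the single functor [klin k S], as the result for a general
   [M] requires. *)
have -> : (fun C => center (kEnd (klin k (gset_restr S (isotropy_incl (rep C)))))
      : pzRingType)
    = (fun C => center (kEnd (krestr (isotropy_incl (rep C)) (klin k S)))).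
  by apply: functional_extensionality_dep => C; rewrite klin_restr.
apply: ring_isomorphic_trans (center_ring_prod _).
exact/ring_isomorphic_center/end_restr_isomorphic.
Qed.
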